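(* Let $P$ be a set of cardinality $d$, and let $$A=\sum_{i\in P}\alpha(i)|a_i\rangle\langle a_i|,\qquad B=\sum_{j\in P}\beta(j)|b_j\rangle\langle b_j|$$ be spectral decompositions of two Hermitian matrices in orthonormal bases $(a_i)_{i\in P}$ and $(b_j)_{j\in P}$, with $\alpha,\beta:P\to\mathbb{R}$. Set $C_{ij}:=\langle a_i,b_j\rangle$. Then for all $k\in\{1,\dots,d\}$, $$\lambda_{[k]}(A+B)\le\max_{S,T\in\binom{P}{k}}\big\{\alpha(S)+\beta(T)\;\big|\;\det C_{S,T}\ne0\big\}.$$
   Context: $\binom{P}{k}$ is the set of $k$-element subsets of $P$. For $f:P\to\mathbb{R}$ and $S\subseteq P$, $f(S):=\sum_{x\in S}f(x)$. $C_{S,T}$ is the submatrix of $C$ with rows indexed by $S$ and columns by $T$ (whether its determinant vanishes does not depend on how $S$ and $T$ are enumerated). For a Hermitian matrix $X$, $\lambda_{[k]}(X)$ is the sum of its $k$ largest eigenvalues (with multiplicity). *)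

(* Defs.v *)
From HB Require Import structures.
From mathcomp Require Import all_boot all_order all_algebra.
From mathcomp Require Import sesquilinear spectral complex.
From mathcomp Require Import classical_sets reals.

Set Implicit Arguments.
Unset Strict Implicit.
Unset Printing Implicit Defensive.

Import Order.TTheory GRing.Theory Num.Theory.
Local Open Scope ring_scope.
Local Open Scope complex_scope.
Local Open Scope sesquilinear_scope.

(* Conjugate-linear in the first argument. *)
Definition inner (R : realType) (d : nat) (u v : 'cV[R[i]]_d) : R[i] :=
  (u ^t* *m v) 0 0.

Definition ketbra (R : realType) (d : nat) (u : 'cV[R[i]]_d) : 'M[R[i]]_d :=
  u *m u ^t*.

Definition orthonormal_basis (R : realType) (d : nat) (P : finType)
    (a : P -> 'cV[R[i]]_d) : Prop :=
  (forall i j : P, inner (a i) (a j) = (i == j)%:R) /\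
  (forall v : 'cV[R[i]]_d, exists c : P -> R[i], v = \sum_i c i *: a i).

(* The roots of the characteristic polynomial, repeated according to their
   multiplicity, in an unspecified order. *)
Definition eigenvalues (R : realType) (n : nat) (X : 'M[R[i]]_n) : seq R[i] :=
  sval (closed_field_poly_normal (char_poly X)).

Lemma char_poly_eigenvalues (R : realType) (n : nat) (X : 'M[R[i]]_n) :
  char_poly X = \prod_(z <- eigenvalues X) ('X - z%:P).
Proof.
rewrite /eigenvalues; case: closed_field_poly_normal => s /= {1}->.
by rewrite (monicP (char_poly_monic X)) scale1r.
Qed.

(* Meant for Hermitian X, whose eigenvalues are real, so that taking real parts
   loses no information. *)
Definition sum_largest_eigenvalues (R : realType) (n k : nat)
    (X : 'M[R[i]]_n) : R :=
  \sum_(x <- take k (sort >=%R [seq complex.Re z | z <- eigenvalues X])) x.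

(* The elements of S and T are listed in the order of their enumeration by the
   finite type P; another order changes the determinant at most by a sign. *)
Definition submatrix (R : realType) (P : finType) (C : P -> P -> R[i]) (k : nat)
    (S T : {set P}) (hS : #|S| = k) (hT : #|T| = k) : 'M[R[i]]_k :=
  \matrix_(i < k, j < k)
    C (enum_val (cast_ord (esym hS) i)) (enum_val (cast_ord (esym hT) j)).

Definition is_max (R : realType) (E : set R) (m : R) : Prop :=
  E m /\ ubound E m.

(* Main.v *)
(* Fix an orthonormal frame v_1, ..., v_k of eigenvectors for the k largest
   eigenvalues of A + B. The minors x_f = det <a_(f i), v_j> and
   y_g = det <b_(g i), v_j>, over all maps f, g : 'I_k -> P, are the coordinates
   of v_1 /\ ... /\ v_k in the two bases of the exterior power, each repeated k!
   times up to sign; indexing by maps instead of k-subsets only costs factors k!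
   in the Cauchy-Binet formula. The quadratic forms of A and B on the frame then
   become the averages of the weights alpha(f) and beta(g) against |x_f|^2 and
   |y_g|^2. If m is the maximum, then for every threshold s the coordinate
   subspaces {alpha(f) > s} and {beta(g) >= m - s} of the exterior power are
   orthogonal, because every transition coefficient det <a_(f i), b_(g j)>
   between them vanishes. Bessel's inequality bounds the total mass on both, and
   summation over the layers s gives the averages of alpha and of beta a sum of
   at most m. *)

Require Import Defs.
From HB Require Import structures.
From mathcomp Require Import all_boot all_order all_algebra.
From mathcomp Require Import fingroup perm ring.
From mathcomp Require Import sesquilinear spectral complex.
From mathcomp Require Import classical_sets reals.

Set Implicit Arguments.
Unset Strict Implicit.
Unset Printing Implicit Defensive.

Import Order.TTheory GRing.Theory Num.Theory.
Local Open Scope ring_scope.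
Local Open Scope complex_scope.

Definition minor (K : comNzRingType) (P : finType) (k : nat)
    (M : P -> 'I_k -> K) (f : {ffun 'I_k -> P}) : K :=
  \det (\matrix_(i, j) M (f i) j).

Definition reindexed (P : finType) (k : nat) (s : 'S_k)
    (f : {ffun 'I_k -> P}) : {ffun 'I_k -> P} := [ffun i => f (s i)].

Lemma minor_reindexed (K : comNzRingType) (P : finType) (k : nat)
    (M : P -> 'I_k -> K) (s : 'S_k) (f : {ffun 'I_k -> P}) :
  minor M (reindexed s f) = (-1) ^+ s * minor M f.
Proof.
rewrite /minor -det_perm -det_mulmx -row_permE; congr (\det _).
by apply/matrixP => i j; rewrite !mxE ffunE.
Qed.

Lemma sum_weighted_minors (K : comNzRingType) (P : finType) (k : nat)
    (w : 'I_k -> P -> K) (M N : P -> 'I_k -> K) :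
  \sum_(f : {ffun 'I_k -> P}) (\prod_i w i (f i)) * (minor M f * minor N f) =
  \sum_(s : 'S_k) \sum_(t : 'S_k) (-1) ^+ s * (-1) ^+ t *
    \prod_i \sum_p w i p * (M p (s i) * N p (t i)).
Proof.
under [RHS]eq_bigr => s _ do under eq_bigr => t _ do
  rewrite bigA_distr_bigA /= mulr_sumr.
under [RHS]eq_bigr => s _ do rewrite exchange_big /=.
rewrite exchange_big /=; apply: eq_bigr => f _.
rewrite /minor /determinant mulr_suml mulr_sumr; apply: eq_bigr => s _.
rewrite mulr_sumr mulr_sumr; apply: eq_bigr => t _.
rewrite mulrACA [LHS]mulrCA !big_split /=; congr (_ * (_ * (_ * _)));
  by apply: eq_bigr => i _; rewrite mxE.
Qed.

Lemma Cauchy_Binet (K : comNzRingType) (P : finType) (k : nat)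
    (M N : P -> 'I_k -> K) :
  \sum_f minor M f * minor N f =
  k`!%:R * \det (\matrix_(i, j) \sum_p M p i * N p j).
Proof.
set G := \matrix_(i, j) _.
transitivity (\sum_(f : {ffun 'I_k -> P})
    (\prod_(i < k) 1) *
    (minor M f * minor N f)).
  by apply: eq_bigr => f _; rewrite big1 // mul1r.
rewrite (sum_weighted_minors (fun _ _ => 1)) (eq_bigr (fun=> \det G)) => [|s _].
  by rewrite sumr_const card_Sn mulr_natl.
under eq_bigr do rewrite -mulrA.
rewrite -mulr_sumr -[RHS](signrMK s) -[in X in _ = _ * X]det_perm.
rewrite -det_mulmx -row_permE; congr (_ * _); apply: eq_bigr => t _.
congr (_ * _); apply: eq_bigr => i _; rewrite !mxE.
by apply: eq_bigr => p _; rewrite mul1r.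
Qed.

(* By additivity the weight may be placed on a single index [i]; the term of a
   pair of permutations [s], [t] then vanishes unless they agree off [i], and
   hence everywhere. *)
Lemma sum_additive_weight_minors (K : comNzRingType) (P : finType) (k : nat)
    (w : P -> K) (M N : P -> 'I_k -> K) :
  (forall i j, \sum_p M p i * N p j = (i == j)%:R) ->
  \sum_(f : {ffun 'I_k -> P}) (\sum_i w (f i)) * (minor M f * minor N f) =
  k`!%:R * \sum_i \sum_p w p * (M p i * N p i).
Proof.
move=> MN.
under eq_bigr do rewrite mulr_suml.
rewrite exchange_big /=.
transitivity (\sum_(i < k) \sum_(s : 'S_k)
    \sum_p w p * (M p (s i) * N p (s i))); last first.
  rewrite exchange_big /= (eq_bigr (fun=> \sum_i \sum_p w p * (M p i * N p i))).
    by rewrite sumr_const card_Sn mulr_natl.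
  by move=> s _; rewrite [RHS](reindex_inj (@perm_inj _ s)).
apply: eq_bigr => i _.
pose W (j : 'I_k) (p : P) := if j == i then w p else 1.
transitivity (\sum_(f : {ffun 'I_k -> P})
    (\prod_j W j (f j)) * (minor M f * minor N f)).
  apply: eq_bigr => f _; rewrite (bigD1 i) //= /W eqxx big1 ?mulr1 //.
  by move=> j /negPf ->.
rewrite (sum_weighted_minors W); apply: eq_bigr => s _.
rewrite (bigD1 s) //= [X in _ + X]big1 ?addr0.
  rewrite -signr_addb addbb mul1r (bigD1 i) //= /W eqxx.
  rewrite [X in _ * X]big1 ?mulr1 // => j /negPf ->.
  by under eq_bigr do rewrite mul1r; rewrite MN eqxx.
move=> t nts.
have [j nji nstj] : exists2 j, j != i & s j != t j.
  apply/exists_inP; apply: contraR nts => /exists_inPn st.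
  have off j : j != i -> t j = s j by move=> /st; rewrite negbK => /eqP.
  apply/eqP/permP => j; have [->|] := eqVneq j i; last exact: off.
  apply/eqP; apply: contraT => nst.
  have : (t^-1)%g (s i) != i by rewrite (can2_eq (permKV t) (permK t)) eq_sym.
  move=> n; have := off _ n; rewrite permKV => /perm_inj/esym/eqP.
  by rewrite (negPf n).
rewrite [X in _ * X](bigD1 j) //= /W (negPf nji).
by under eq_bigr do rewrite mul1r; rewrite MN (negPf nstj) mul0r mulr0.
Qed.

Lemma sum_antisymmetric (K : comNzRingType) (P : finType) (k : nat)
    (z : {ffun 'I_k -> P} -> K) (f : {ffun 'I_k -> P}) :
  (forall s g, z (reindexed s g) = (-1) ^+ s * z g) ->
  \sum_(g : {ffun 'I_k -> P})
    \det (\matrix_(i < k, j < k) (f i == g j)%:R) * z g = k`!%:R * z f.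
Proof.
move=> zA; under eq_bigr do rewrite /determinant mulr_suml.
rewrite exchange_big /= (eq_bigr (fun=> z f)) => [|s _].
  by rewrite sumr_const card_Sn mulr_natl.
rewrite (bigD1 (reindexed s^-1 f)) //= [X in _ + X]big1 ?addr0 => [|g ng].
  rewrite big1 ?mulr1 => [|i _]; last by rewrite mxE ffunE permK eqxx.
  by rewrite zA odd_permV signrMK.
have [i nfg] : exists i, f i != g (s i).
  apply/existsP; apply: contraR ng => /existsPn fg.
  apply/eqP/ffunP => i; have := fg ((s^-1)%g i).
  by rewrite negbK ffunE permKV => /eqP.
by rewrite (bigD1 i) //= mxE (negPf nfg) mul0r mulr0 mul0r.
Qed.

Lemma Bessel_minors (K : numClosedFieldType) (P : finType) (k : nat)
    (C : P -> P -> K) (Y X : P -> 'I_k -> K) (D E : pred {ffun 'I_k -> P}) :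
  (forall p p', \sum_q C p q * (C p' q)^*%R = (p == p')%:R) ->
  (forall p j, X p j = \sum_q C p q * Y q j) ->
  (forall s f, D (reindexed s f) = D f) ->
  (forall f g : {ffun 'I_k -> P}, D f -> E g ->
     \det (\matrix_(i, j) C (f i) (g j)) = 0) ->
  \sum_(f | D f) `|minor X f| ^+ 2 + \sum_(g | E g) `|minor Y g| ^+ 2 <=
  \sum_g `|minor Y g| ^+ 2.
Proof.
move=> CC XE DA DE; set Q := \sum_(f | D f) _.
pose N : K := k`!%:R.
have N_gt0 : 0 < N by rewrite ltr0n fact_gt0.
have NJ : N^*%R = N by rewrite rmorph_nat.
pose G (f g : {ffun 'I_k -> P}) : K := \det (\matrix_(i, j) C (f i) (g j)).
pose x f := if D f then minor X f else 0.
pose p g := \sum_f (G f g)^*%R * x f.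
have GT f g : G f g = minor (fun q i => C (f i) q) g.
  by rewrite /G -det_tr; congr (\det _); apply/matrixP => i j; rewrite !mxE.
have Gy f : \sum_g G f g * minor Y g = N * minor X f.
  under eq_bigr do rewrite GT.
  rewrite Cauchy_Binet; congr (_ * \det _).
  by apply/matrixP => i j; rewrite !mxE XE.
have GG f f' : \sum_g G f g * (G f' g)^*%R =
    N * \det (\matrix_(i < k, j < k) (f i == f' j)%:R).
  transitivity (\sum_g G f g * minor (fun q i => (C (f' i) q)^*%R) g).
    apply: eq_bigr => g _; rewrite !GT /minor -det_map_mx; congr (_ * \det _).
    by apply/matrixP => i j; rewrite !mxE.
  under eq_bigr do rewrite GT.
  rewrite Cauchy_Binet; congr (_ * \det _).
  by apply/matrixP => i j; rewrite !mxE CC.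
have xA s f : x (reindexed s f) = (-1) ^+ s * x f.
  by rewrite /x DA minor_reindexed; case: ifP => // _; rewrite mulr0.
have Gp f : \sum_g G f g * p g = N ^+ 2 * x f.
  under eq_bigr do rewrite mulr_sumr.
  rewrite exchange_big /= expr2 -mulrA -(sum_antisymmetric f xA) mulr_sumr.
  apply: eq_bigr => f' _; under eq_bigr do rewrite mulrA.
  by rewrite -mulr_suml GG mulrA.
have pE u : \sum_g u g * (p g)^*%R = \sum_f (x f)^*%R * \sum_g G f g * u g.
  under eq_bigr do rewrite rmorph_sum mulr_sumr.
  rewrite exchange_big /=; apply: eq_bigr => f _; rewrite mulr_sumr.
  by apply: eq_bigr => g _; rewrite rmorphM /= conjCK mulrC -mulrA mulrCA.
have QE : \sum_f (x f)^*%R * minor X f = Q.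
  rewrite /Q [RHS]big_mkcond; apply: eq_bigr => f _; rewrite /x.
  by case: ifP => _; rewrite ?rmorph0 ?mul0r // normCK mulrC.
have yp : \sum_g minor Y g * (p g)^*%R = N * Q.
  rewrite pE -QE mulr_sumr; apply: eq_bigr => f _.
  by rewrite Gy mulrCA.
have pp : \sum_g p g * (p g)^*%R = N ^+ 2 * Q.
  rewrite pE -QE mulr_sumr; apply: eq_bigr => f _.
  rewrite Gp mulrCA /x; case: ifP => // _.
  by rewrite !(rmorph0, mul0r, mulr0).
have QJ : Q^*%R = Q.
  by apply: geC0_conj; apply: sumr_ge0 => f _; apply: exprn_ge0.
have p0 g : E g -> p g = 0.
  move=> Eg; rewrite /p big1 // => f _; rewrite /x; case: ifP => [Df|_].
    by rewrite /G (DE _ _ Df Eg) rmorph0 mul0r.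
  by rewrite mulr0.
have drop u v : (forall g, E g -> v g = 0) ->
    \sum_(g | ~~ E g) u g * v g = \sum_g u g * v g :> K.
  move=> v0; rewrite [RHS](bigID E) /= [X in _ = X + _]big1 ?add0r // => g.
  by move=> /v0 ->; rewrite mulr0.
have pJ0 g : E g -> (p g)^*%R = 0 by move/p0 ->; rewrite rmorph0.
have : 0 <= \sum_(g | ~~ E g) `|N * minor Y g - p g| ^+ 2.
  by apply: sumr_ge0 => g _; apply: exprn_ge0.
rewrite [X in 0 <= X](_ : _ =
    N ^+ 2 * (\sum_(g | ~~ E g) `|minor Y g| ^+ 2 - Q)).
  rewrite pmulr_rge0 ?exprn_gt0 // subr_ge0 => le.
  by rewrite [leRHS](bigID E) /= [leRHS]addrC lerD2r.
transitivity (N ^+ 2 * \sum_(g | ~~ E g) `|minor Y g| ^+ 2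
    - N * \sum_(g | ~~ E g) minor Y g * (p g)^*%R
    - N * (\sum_(g | ~~ E g) minor Y g * (p g)^*%R)^*%R
    + \sum_(g | ~~ E g) p g * (p g)^*%R).
  rewrite rmorph_sum !mulr_sumr -!sumrB -big_split; apply: eq_bigr => g _ /=.
  rewrite !normCK rmorphB !rmorphM /= NJ conjCK; ring.
have -> := drop (minor Y) _ pJ0; have -> := drop p _ pJ0.
rewrite yp pp rmorphM /= NJ QJ; ring.
Qed.

(* Induction on the number of positive values of [v]: lowering all of them by
   the least one peels off a single layer [{v > 0}]. *)
Lemma layer_cake_le0 (K : numDomainType) (I : finType) (v w : I -> K) :
  (forall i, 0 <= v i) ->
  (forall s, 0 <= s -> \sum_(i | s < v i) w i <= 0) ->
  \sum_i v i * w i <= 0.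
Proof.
move En : #|[pred i | 0 < v i]| => n.
elim/ltn_ind: n v En => n IH v En v0 layer.
have [i0 vi0|none] := pickP [pred i | 0 < v i]; last first.
  rewrite big1 // => i _; move: (none i) => /=.
  by rewrite lt0r v0 andbT => /negbFE/eqP ->; rewrite mul0r.
have vR : {in [pred i | 0 < v i], forall i, v i \is Num.real}.
  by move=> i _; exact: ger0_real.
have [j /= vj jmin] := real_arg_minP vi0 vR.
pose v' i := if 0 < v i then v i - v j else 0.
have v'0 i : 0 <= v' i.
  by rewrite /v'; case: ifP => // vi; rewrite subr_ge0 jmin.
have v'lt s i : 0 <= s -> (s < v' i) = (s + v j < v i).
  move=> s0; rewrite /v'; case: ifPn => [_|]; first by rewrite ltrBrDr.
  rewrite lt0r v0 andbT negbK => /eqP ->.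
  by rewrite (le_gtF s0) le_gtF // addr_ge0.
have -> : \sum_i v i * w i = \sum_i v' i * w i + v j * \sum_(i | 0 < v i) w i.
  rewrite mulr_sumr [in X in _ + X]big_mkcond -big_split.
  apply: eq_bigr => i _ /=.
  rewrite /v'; case: ifPn => [_|]; first by rewrite mulrBl subrK.
  by rewrite lt0r v0 andbT negbK => /eqP ->; rewrite !mul0r addr0.
rewrite -[leRHS]addr0 lerD ?mulr_ge0_le0 ?layer ?v0 //.
have lt_n : (#|[pred i | (0 < v' i)%R]| < n)%N.
  rewrite -En; apply: proper_card; apply/properP; split.
    apply/fintype.subsetP => i; rewrite !inE v'lt // add0r.
    exact: lt_trans.
  by exists j; rewrite !inE // v'lt // add0r ltxx.
apply: (IH _ lt_n v' erefl v'0) => s s0; under eq_bigl do rewrite v'lt //.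
by apply: layer; rewrite addr_ge0.
Qed.

Lemma finite_shift_ge0 (K : numDomainType) (I : finType) (c : I -> K) :
  (forall i, c i \is Num.real) -> exists L, forall i, 0 <= c i + L.
Proof.
move=> cR; exists (\sum_i `|c i|) => i.
rewrite (bigD1 i) //= addrA addr_ge0 ?sumr_ge0 //.
have := lexx `|c i|; rewrite real_ler_norml // => /andP[lo _].
by move: lo; rewrite -subr_ge0 opprK.
Qed.

Lemma weighted_minors_le (K : numClosedFieldType) (P : finType) (k : nat)
    (C : P -> P -> K) (Y X : P -> 'I_k -> K) (a b : {ffun 'I_k -> P} -> K)
    (m : K) :
  (forall p p', \sum_q C p q * (C p' q)^*%R = (p == p')%:R) ->
  (forall p j, X p j = \sum_q C p q * Y q j) ->
  (forall f, a f \is Num.real) -> (forall f, b f \is Num.real) ->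
  m \is Num.real ->
  (forall s f, a (reindexed s f) = a f) ->
  (forall f g : {ffun 'I_k -> P},
     \det (\matrix_(i, j) C (f i) (g j)) != 0 -> a f + b g <= m) ->
  \sum_f `|minor X f| ^+ 2 = \sum_f `|minor Y f| ^+ 2 ->
  \sum_f a f * `|minor X f| ^+ 2 + \sum_g b g * `|minor Y g| ^+ 2 <=
  m * \sum_g `|minor Y g| ^+ 2.
Proof.
move=> CC XE aR bR mR aS abm XY.
pose c (i : {ffun 'I_k -> P} + {ffun 'I_k -> P}) : K :=
  match i with inl f => a f | inr g => m - b g end.
have [L v0] : exists L, forall i, 0 <= c i + L.
  by apply: finite_shift_ge0 => -[f|g] /=; [exact: aR|exact: realB].
pose w (i : {ffun 'I_k -> P} + {ffun 'I_k -> P}) : K :=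
  match i with inl f => `|minor X f| ^+ 2 | inr g => - `|minor Y g| ^+ 2 end.
have layer s : 0 <= s -> \sum_(i | s < c i + L) w i <= 0.
  move=> s0; rewrite big_sumType /= sumrN subr_le0.
  pose D := [pred f : {ffun 'I_k -> P} | s < a f + L].
  pose E := [pred g : {ffun 'I_k -> P} | ~~ (s < m - b g + L)].
  have DA t f : D (reindexed t f) = D f by rewrite /D /= aS.
  have DE (f g : {ffun 'I_k -> P}) : D f -> E g ->
      \det (\matrix_(i, j) C (f i) (g j)) = 0.
    rewrite /D /E /= -real_leNgt ?ger0_real ?(v0 (inr g)) // => sa bs.
    apply: contraTeq (le_lt_trans bs sa) => /abm.
    by rewrite ltrD2r ltrBlDr => le; rewrite le_gtF.
  have := Bessel_minors CC XE DA DE.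
  by rewrite [leRHS](bigID [pred g | s < m - b g + L]) /= lerD2r.
have := layer_cake_le0 v0 layer; rewrite big_sumType /=.
under [X in X + _]eq_bigr do rewrite mulrDl.
under [X in _ + X]eq_bigr do
  rewrite mulrN -mulNr opprD opprB mulrDl mulrBl mulNr.
rewrite !big_split /= !sumrN -!mulr_sumr XY => le.
rewrite -subr_le0; apply: le_trans le; rewrite le_eqVlt; apply/orP; left.
by apply/eqP; ring.
Qed.

Lemma inner_conj (R : realType) (d : nat) (u v : 'cV[R[i]]_d) :
  (inner u v)^*%R = inner v u.
Proof.
rewrite /inner !mxE rmorph_sum; apply: eq_bigr => i _.
by rewrite !mxE rmorphM /= conjCK mulrC.
Qed.

Lemma inner_sumr (R : realType) (d : nat) (I : finType) (u : 'cV[R[i]]_d)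
    (c : I -> R[i]) (v : I -> 'cV[R[i]]_d) :
  inner u (\sum_i c i *: v i) = \sum_i c i * inner u (v i).
Proof.
rewrite /inner mulmx_sumr summxE; apply: eq_bigr => i _.
by rewrite -scalemxAr mxE.
Qed.

Lemma orthonormal_expansion (R : realType) (d : nat) (P : finType)
    (a : P -> 'cV[R[i]]_d) (v : 'cV[R[i]]_d) :
  orthonormal_basis a -> v = \sum_p inner (a p) v *: a p.
Proof.
move=> [aO /(_ v) [c vE]]; rewrite {1}vE; apply: eq_bigr => p _.
rewrite vE inner_sumr (bigD1 p) //= aO eqxx mulr1 big1 ?addr0 // => q.
by rewrite aO eq_sym => /negPf ->; rewrite mulr0.
Qed.

Lemma Parseval (R : realType) (d : nat) (P : finType)
    (a : P -> 'cV[R[i]]_d) (u v : 'cV[R[i]]_d) :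
  orthonormal_basis a ->
  \sum_p (inner (a p) u)^*%R * inner (a p) v = inner u v.
Proof.
move=> aO; rewrite {2}(orthonormal_expansion v aO) inner_sumr.
by apply: eq_bigr => p _; rewrite inner_conj mulrC.
Qed.

Lemma inner_spectral (R : realType) (d : nat) (P : finType) (alpha : P -> R)
    (a : P -> 'cV[R[i]]_d) (v : 'cV[R[i]]_d) :
  inner v ((\sum_p (alpha p)%:C *: ketbra (a p)) *m v) =
  \sum_p (alpha p)%:C * `|inner (a p) v| ^+ 2.
Proof.
rewrite mulmx_suml.
under eq_bigr do rewrite -scalemxAl.
rewrite inner_sumr; apply: eq_bigr => p _; congr (_ * _).
rewrite normCK inner_conj mulrC /ketbra /inner -mulmxA [_ *m (a p *m _)]mulmxA.
by rewrite [LHS]mxE big_ord1.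
Qed.

Lemma orthonormal_frame_trace_le (R : realType) (d : nat) (P : finType)
    (alpha beta : P -> R) (a b : P -> 'cV[R[i]]_d) (k : nat)
    (v : 'I_k -> 'cV[R[i]]_d) (m : R) :
  orthonormal_basis a -> orthonormal_basis b ->
  (forall i j, inner (v i) (v j) = (i == j)%:R) ->
  (forall f g : {ffun 'I_k -> P},
     \det (\matrix_(i, j) inner (a (f i)) (b (g j))) != 0 ->
     \sum_i alpha (f i) + \sum_j beta (g j) <= m) ->
  \sum_j inner (v j) ((\sum_p (alpha p)%:C *: ketbra (a p) +
                       \sum_p (beta p)%:C *: ketbra (b p)) *m v j) <= m%:C.
Proof.
move=> aO bO vO abm.
pose coords (c : P -> 'cV[R[i]]_d) p j := inner (c p) (v j).
have minorsE (c : P -> 'cV[R[i]]_d) (w : P -> R[i]) : orthonormal_basis c ->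
    \sum_(f : {ffun 'I_k -> P}) (\sum_i w (f i)) * `|minor (coords c) f| ^+ 2 =
    k`!%:R * \sum_j \sum_p w p * `|coords c p j| ^+ 2.
  move=> cO; transitivity (\sum_(f : {ffun 'I_k -> P}) (\sum_i w (f i)) *
      (minor (fun p j => (coords c p j)^*%R) f * minor (coords c) f)).
    apply: eq_bigr => f _; rewrite normCK; congr (_ * _).
    rewrite mulrC /minor -det_map_mx; congr (\det _ * _).
    by apply/matrixP => i j; rewrite !mxE.
  rewrite sum_additive_weight_minors => [|i j]; last by rewrite Parseval.
  congr (_ * _); apply: eq_bigr => j _; apply: eq_bigr => p _.
  by rewrite normCK [_^*%R * _]mulrC.
have minors1 (c : P -> 'cV[R[i]]_d) : orthonormal_basis c ->
    \sum_f `|minor (coords c) f| ^+ 2 = k`!%:R.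
  move=> cO; transitivity (\sum_f minor (fun p j => (coords c p j)^*%R) f *
      minor (coords c) f).
    apply: eq_bigr => f _; rewrite normCK mulrC; congr (_ * _).
    rewrite /minor -det_map_mx; congr (\det _).
    by apply/matrixP => i j; rewrite !mxE.
  rewrite Cauchy_Binet (_ : \matrix_(i, j) _ = 1%:M) ?det1 ?mulr1 //.
  by apply/matrixP => i j; rewrite !mxE Parseval.
have CR (x : R) : x%:C \is Num.real by rewrite complex_real.
have := @weighted_minors_le _ P k (fun p q => inner (a p) (b q)) (coords b)
  (coords a) (fun f => \sum_i (alpha (f i))%:C)
  (fun g => \sum_i (beta (g i))%:C) m%:C.
rewrite (minorsE a (fun p => (alpha p)%:C)) //.
rewrite (minorsE b (fun p => (beta p)%:C)) // !minors1 //.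
rewrite -mulrDr [m%:C * _]mulrC.
rewrite ler_pM2l ?ltr0n ?fact_gt0 // => main.
under eq_bigr do
  rewrite mulmxDl /inner mulmxDr mxE -!/(inner _ _) !inner_spectral.
rewrite big_split /=; apply: main => //.
- move=> p p'; rewrite -(proj1 aO) -(Parseval _ _ bO).
  by apply: eq_bigr => q _; rewrite !inner_conj mulrC.
- move=> p j; rewrite /coords -(Parseval _ _ bO).
  by apply: eq_bigr => q _; rewrite inner_conj.
- by move=> f; apply: rpred_sum.
- by move=> f; apply: rpred_sum.
- move=> s f; rewrite [RHS](reindex_inj (@perm_inj _ s)).
  by apply: eq_bigr => i _; rewrite ffunE.
- by move=> f g /abm; rewrite -!rmorph_sum -rmorphD lecR.
Qed.

Lemma char_poly_spectral (K : numClosedFieldType) (n : nat) (H : 'M[K]_n) :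
  H \is hermsymmx ->
  char_poly H = \prod_i ('X - (spectral_diag H 0 i)%:P).
Proof.
move=> /hermitian_normalmx/orthomx_spectralP; set U := spectralmx H => HE.
have Uunit : U \in unitmx by apply: spectral_unit.
have -> : char_poly H = char_poly (diag_mx (spectral_diag H)).
  have XE : char_poly_mx H = map_mx polyC (invmx U) *m
      char_poly_mx (diag_mx (spectral_diag H)) *m map_mx polyC U.
    rewrite /char_poly_mx mulmxBr mulmxBl -!map_mxM -HE; congr (_ - _).
    by rewrite scalar_mxC -mulmxA -map_mxM mulVmx // map_mx1 mulmx1.
  rewrite /char_poly XE !det_mulmx mulrAC -det_mulmx -map_mxM mulVmx //.
  by rewrite map_mx1 det1 mul1r.
rewrite char_poly_trig ?diag_mx_is_trig //.
by apply: eq_bigr => i _; rewrite mxE eqxx.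
Qed.

Lemma sum_largest_spectral (R : realType) (d k : nat) (H : 'M[R[i]]_d) :
  H \is hermsymmx -> (0 < k <= d)%N ->
  exists2 h : 'I_k -> 'I_d, injective h &
    sum_largest_eigenvalues k H =
    \sum_j complex.Re (spectral_diag H 0 (h j)).
Proof.
move=> Hherm /andP[k_gt0 kd].
pose r (i : 'I_d) := complex.Re (spectral_diag H 0 i).
have eigE : perm_eq (eigenvalues H) [seq spectral_diag H 0 i | i <- enum 'I_d].
  apply: prod_XsubC_eq.
  by rewrite -char_poly_eigenvalues char_poly_spectral // big_map big_enum.
pose s := sort (relpre r >=%R) (enum 'I_d).
have s_size : size s = d by rewrite size_sort size_enum_ord.
have s_uniq : uniq s by rewrite sort_uniq enum_uniq.
have i0 : 'I_d by apply: (Ordinal (leq_trans k_gt0 kd)).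
exists (fun j : 'I_k => nth i0 s j) => [i j /eqP|].
  rewrite nth_uniq ?s_size ?(leq_trans (ltn_ord _)) // => /eqP.
  exact: val_inj.
rewrite /sum_largest_eigenvalues.
have -> : sort >=%R [seq complex.Re z | z <- eigenvalues H] = map r s.
  rewrite -sort_map; apply/perm_sortP.
  - exact: ge_total.
  - exact: ge_trans.
  - exact: ge_anti.
  - by rewrite (perm_trans (perm_map _ eigE)) // -map_comp.
rewrite -map_take big_map (big_nth i0) big_mkord size_takel ?s_size //.
by apply: eq_bigr => j _; rewrite nth_take.
Qed.

Lemma hermsymmxD (K : numClosedFieldType) (n : nat) (A B : 'M[K]_n) :
  A \is hermsymmx -> B \is hermsymmx -> A + B \is hermsymmx.
Proof.
move=> /is_hermitianmxP AH /is_hermitianmxP BH; apply/is_hermitianmxP.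
move: AH BH; rewrite expr0 !scale1r => AH BH.
by rewrite {1}AH {1}BH linearD map_mxD.
Qed.

Lemma top_eigenvector_frame (R : realType) (d k : nat) (H : 'M[R[i]]_d) :
  H \is hermsymmx -> (0 < k <= d)%N ->
  exists2 v : 'I_k -> 'cV[R[i]]_d,
    forall i j, inner (v i) (v j) = (i == j)%:R &
    (sum_largest_eigenvalues k H)%:C = \sum_j inner (v j) (H *m v j).
Proof.
move=> Hherm /(sum_largest_spectral Hherm)[h h_inj ->].
set U := spectralmx H.
have UU : U *m (U ^t*)%sesqui = 1%:M by apply/unitarymxP/spectral_unitarymx.
have innerE (M : 'M_d) i j :
    inner ((row (h i) U) ^t*)%sesqui (M *m (row (h j) U) ^t*)%sesqui =
    (U *m M *m (U ^t*)%sesqui) (h i) (h j).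
  rewrite /inner trmxCK mulmxA -row_mul.
  by rewrite !mxE; apply: eq_bigr => l _; rewrite !mxE.
exists (fun j => (row (h j) U) ^t*)%sesqui => [i j|].
  rewrite -[X in inner _ X]mul1mx innerE mulmx1 UU mxE.
  by rewrite (inj_eq h_inj).
rewrite rmorph_sum; apply: eq_bigr => j _ /=.
rewrite innerE RRe_real; last first.
  by have /mxOverP := hermitian_spectral_diag_real Hherm.
have /hermitian_normalmx/orthomx_spectralP HE := Hherm.
rewrite {2}HE -/U !mulmxA mulmxV ?spectral_unit // mul1mx -mulmxA UU mulmx1.
by rewrite mxE eqxx.
Qed.

Lemma mxsub_factor_det0 (K : comNzRingType) (k : nat) (M N : 'M[K]_k)
    (s t : 'I_k -> 'I_k) :
  (forall i j, N i j = M (s i) (t j)) -> \det N != 0 -> \det M != 0.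
Proof.
move=> NE; apply: contraNneq => M0.
have -> : N = mxsub s t (M *m 1%:M).
  by apply/matrixP => i j; rewrite mulmx1 mxE NE.
by rewrite mxsub_mul rowsubE !det_mulmx M0 mulr0 mul0r.
Qed.

Lemma det_rows_inj (K : comNzRingType) (T : Type) (k : nat) (f : 'I_k -> T)
    (M : T -> 'I_k -> K) :
  \det (\matrix_(i, j) M (f i) j) != 0 -> injective f.
Proof.
move=> det_neq0 i j fij; apply: contraNeq det_neq0 => nij.
apply/eqP; apply: (determinant_alternate nij) => l.
by rewrite !mxE fij.
Qed.

Lemma im_enum_index (P : finType) (k : nat) (f : {ffun 'I_k -> P}) :
  injective f ->
  exists (S : {set P}) (hS : #|S| = k) (s : 'I_k -> 'I_k),
    (forall i, f i = enum_val (cast_ord (esym hS) (s i))) /\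
    (forall (V : nmodType) (w : P -> V), \sum_(p in S) w p = \sum_i w (f i)).
Proof.
move=> f_inj; exists [set f i | i in 'I_k].
have fS i : f i \in [set f i | i in 'I_k] by apply: imset_f.
have hS : #|[set f i | i in 'I_k]| = k by rewrite card_imset // card_ord.
exists hS, (fun i => cast_ord hS (enum_rank_in (fS i) (f i))); split=> [i|V w].
  by rewrite cast_ordK enum_rankK_in.
by rewrite big_imset //= => i j _ _; apply: f_inj.
Qed.

Lemma sum_enum_val_cast (V : nmodType) (P : finType) (S : {set P}) (k : nat)
    (hS : #|S| = k) (w : P -> V) :
  \sum_(p in S) w p = \sum_(i < k) w (enum_val (cast_ord (esym hS) i)).
Proof.
case: k / hS; rewrite big_enum_val.
by under [RHS]eq_bigr do rewrite cast_ord_id.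
Qed.

Lemma det_nonzero_sets (R : realType) (P : finType) (C : P -> P -> R[i])
    (alpha beta : P -> R) (k : nat) (x : R) :
  (exists (S T : {set P}) (hS : #|S| = k) (hT : #|T| = k),
     \det (submatrix C hS hT) != 0 /\
     x = \sum_(i in S) alpha i + \sum_(j in T) beta j) <->
  (exists f g : {ffun 'I_k -> P},
     \det (\matrix_(i, j) C (f i) (g j)) != 0 /\
     x = \sum_i alpha (f i) + \sum_j beta (g j)).
Proof.
split=> [[S [T [hS [hT [dC ->]]]]]|[f [g [dC ->]]]].
  exists [ffun i => enum_val (cast_ord (esym hS) i)].
  exists [ffun j => enum_val (cast_ord (esym hT) j)]; split.
    rewrite (_ : \matrix_(i, j) _ = submatrix C hS hT) //.
    by apply/matrixP => i j; rewrite !mxE !ffunE.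
  rewrite !(sum_enum_val_cast hS, sum_enum_val_cast hT).
  by congr (_ + _); apply: eq_bigr => i _; rewrite ffunE.
have f_inj : injective f := det_rows_inj (M := fun p j => C p (g j)) dC.
have g_inj : injective g.
  apply: (det_rows_inj (M := fun q i => C (f i) q)).
  rewrite -det_tr (_ : _^T = \matrix_(i, j) C (f i) (g j)) //.
  by apply/matrixP => i j; rewrite !mxE.
have [S [hS [s [fE SE]]]] := im_enum_index f_inj.
have [T [hT [t [gE TE]]]] := im_enum_index g_inj.
exists S, T, hS, hT; rewrite SE TE; split=> //.
by apply: mxsub_factor_det0 dC => i j; rewrite !mxE fE gE.
Qed.

Theorem lemma2 (R : realType) (d : nat) (P : finType) (hP : #|P| = d)
    (A B : 'M[R[i]]_d) (hA : A \is hermsymmx) (hB : B \is hermsymmx)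
    (alpha beta : P -> R) (a b : P -> 'cV[R[i]]_d)
    (ha : orthonormal_basis a) (hb : orthonormal_basis b)
    (hAa : A = \sum_i (alpha i)%:C *: ketbra (a i))
    (hBb : B = \sum_j (beta j)%:C *: ketbra (b j))
    (C : P -> P -> R[i]) (hC : forall i j : P, C i j = inner (a i) (b j))
    (k : nat) (hk : (1 <= k <= d)%N) :
  exists2 m : R,
    is_max (fun x : R => exists (S T : {set P}) (hS : #|S| = k) (hT : #|T| = k),
              \det (submatrix C hS hT) != 0 /\
              x = \sum_(i in S) alpha i + \sum_(j in T) beta j) m &
    sum_largest_eigenvalues k (A + B) <= m.
Proof.
have [v vO sumE] := top_eigenvector_frame (hermsymmxD hA hB) hk.
pose G (p : {ffun 'I_k -> P} * {ffun 'I_k -> P}) :=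
  \det (\matrix_(i, j) C (p.1 i) (p.2 j)).
pose wt (p : {ffun 'I_k -> P} * {ffun 'I_k -> P}) :=
  \sum_i alpha (p.1 i) + \sum_j beta (p.2 j).
have bound m : (forall p, G p != 0 -> wt p <= m) ->
    sum_largest_eigenvalues k (A + B) <= m.
  move=> Gm; rewrite -lecR sumE hAa hBb; apply: orthonormal_frame_trace_le => //.
  move=> f g dC; apply: (Gm (f, g)); rewrite /G /=.
  by under eq_mx do rewrite hC.
have [p0 Gp0] : exists p, G p != 0.
  (* Without a nonzero minor the bound would hold for every real [m]. *)
  apply/existsP; apply: contraT => /existsPn noG.
  have := bound (sum_largest_eigenvalues k (A + B) - 1).
  rewrite lerDl oppr_ge0 ler10; apply.
  by move=> p; rewrite (negPf (noG p)).
have [p Gp pmax] := @arg_maxP _ _ _ p0 (fun p => G p != 0) wt Gp0.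
exists (wt p); last exact: bound.
split.
  by apply/det_nonzero_sets; exists p.1, p.2.
move=> x /det_nonzero_sets[f [g [dC ->]]].
exact: (pmax (f, g)).
Qed.
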